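(* Every 2-local derivation of a finite dimensional formally real exceptional simple Jordan algebra $\mathcal{A}$ is a derivation.
   Context: A real Jordan algebra is formally real if $\sum_i a_i^2=0$ (finite sum) implies each $a_i=0$. Exceptional means not special, i.e. not isomorphic to a Jordan subalgebra of $R^+$ (with product $\frac12(ab+ba)$) for an associative algebra $R$. A derivation is a linear map $D$ with $D(xy)=D(x)y+xD(y)$. A 2-local derivation is a map $\Delta$ (not assumed linear) such that for every $x,y$ there is a derivation $D_{x,y}$ with $\Delta(x)=D_{x,y}(x)$, $\Delta(y)=D_{x,y}(y)$. *)

(* Defs.v *)
From HB Require Import structures.
From mathcomp Require Import all_boot all_order all_algebra.
From mathcomp Require Import reals.
Set Implicit Arguments. Unset Strict Implicit. Unset Printing Implicit Defensive.
Import Order.TTheory GRing.Theory Num.Theory.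
Local Open Scope ring_scope.

Section Jordan.
Variables (R : realType) (V : vectType R).

(* bilinear (left linearity + commutativity gives right linearity),
   commutative, and satisfying the Jordan identity (x^2 y) x = x^2 (y x). *)
Definition jordan_algebra (mul : V -> V -> V) : Prop :=
  [/\ forall (a : R) (x y z : V), mul (a *: x + y) z = a *: mul x z + mul y z,
      forall x y : V, mul x y = mul y x &
      forall x y : V, mul (mul (mul x x) y) x = mul (mul x x) (mul y x)].

Definition formally_real (mul : V -> V -> V) : Prop :=
  forall (n : nat) (a : 'I_n -> V),
    \sum_(i < n) mul (a i) (a i) = 0 -> forall i, a i = 0.

(* (two-sided, since mul is commutative) ideal: a subspace I with A I <= I *)
Definition jideal (mul : V -> V -> V) (I : {vspace V}) : Prop :=
  forall x y : V, y \in I -> mul x y \in I.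

Definition jsimple (mul : V -> V -> V) : Prop :=
  (exists x y : V, mul x y != 0) /\
  forall I : {vspace V}, jideal mul I -> I = 0%VS \/ I = fullv.

(* special: isomorphic to a Jordan subalgebra of B^+ for some associative
   R-algebra B, i.e. there is an injective linear map f : V -> B with
   f (x y) = 1/2 (f x f y + f y f x). *)
Definition jspecial (mul : V -> V -> V) : Prop :=
  exists (B : algType R) (f : V -> B),
    [/\ forall (a : R) (x y : V), f (a *: x + y) = a *: f x + f y,
        injective f &
        forall x y : V, f (mul x y) = 2^-1 *: (f x * f y + f y * f x)].

Definition jexceptional (mul : V -> V -> V) : Prop := ~ jspecial mul.

Definition jderivation (mul : V -> V -> V) (D : V -> V) : Prop :=
  (forall (a : R) (x y : V), D (a *: x + y) = a *: D x + D y) /\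
  (forall x y : V, D (mul x y) = mul (D x) y + mul x (D y)).

Definition two_local_derivation (mul : V -> V -> V) (Delta : V -> V) : Prop :=
  forall x y : V, exists D : V -> V,
    [/\ jderivation mul D, Delta x = D x & Delta y = D y].

End Jordan.

(* Main.v *)
(* The form tau(x,y) = tr L_(xy) is skew under derivations, because
   L_(D x) = [D, L_x] has trace 0; applied to the inner derivations [L_z, L_x]
   this makes tau associative, so its radical is an ideal.  A formally real
   algebra has a nonzero idempotent e, and tau(e,e) = tr L_e > 0 as L_e is
   diagonalizable with eigenvalues in {0, 1/2, 1} and L_e e = e.  By simplicity
   tau is nondegenerate.  A 2-local derivation is then skew for tau, hence
   linear; the pair (x, x^2) gives Delta(x^2) = 2 x Delta(x), which polarizes
   to the Leibniz rule. *)
Require Import Defs.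
From HB Require Import structures.
From mathcomp Require Import all_boot all_order all_algebra.
From mathcomp Require Import reals lra.
Set Implicit Arguments. Unset Strict Implicit.
Unset Printing Implicit Defensive.
Import Order.TTheory GRing.Theory Num.Theory.
Import VectorInternalTheory passmx.
Local Open Scope ring_scope.

(** * Matrix traces and cyclic subspaces *)

(** In a full-rank factorization P = C B, idempotence forces B C = 1, an identity matrix of size
    rank P; and tr (C B) = tr (B C). *)
Lemma mxtrace_idem (F : fieldType) (n : nat) (P : 'M[F]_n) :
  P *m P = P -> \tr P = (\rank P)%:R.
Proof.
move=> PP; have := mulmx_base P.
move: (col_base P) (row_base P) (col_base_full P) (row_base_free P).
move=> C B fC fB CB.
have BC : B *m C = 1%:M.
  apply: (row_full_inj fC); apply: (row_free_inj fB).
  by rewrite /= mulmx1 !mulmxA CB -mulmxA CB.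
by rewrite -{1}CB mxtrace_mulC BC mxtrace1.
Qed.

(* The eigenvalues are 0, 1/2 and 1, with spectral projections [P] for 1 and
   [Q] for 1/2. *)
Lemma mxtrace_peirce_gt0 (F : realFieldType) (n : nat) (A : 'M[F]_n)
    (u : 'rV[F]_n) :
  2 *: (A *m A *m A) = 3 *: (A *m A) - A -> u *m A = u -> u != 0 -> 0 < \tr A.
Proof.
move=> A3 uA u0.
have {}A3 : A *m A *m A = (3 / 2) *: (A *m A) - 2^-1 *: A.
  apply: (@scalerI _ _ 2); first by rewrite pnatr_eq0.
  rewrite A3 scalerBr !scalerA mulrCA divff ?pnatr_eq0 // mulr1.
  by rewrite scale1r.
have A4 : A *m A *m (A *m A) = (7 / 4) *: (A *m A) - (3 / 4) *: A.
  rewrite mulmxA A3 mulmxBl -!scalemxAl A3.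
  by apply/matrixP=> i j; rewrite !mxE; lra.
(* The Lagrange polynomials 2 t^2 - t and 4 t - 4 t^2 for the nodes 1 and 1/2 among 0, 1/2, 1,
   evaluated at A. *)
pose P := 2 *: (A *m A) - A; pose Q := 4 *: A - 4 *: (A *m A).
have PP : P *m P = P.
  rewrite /P mulmxBl !mulmxBr -!scalemxAl -!scalemxAr A4 A3 mulmxA A3.
  by apply/matrixP=> i j; rewrite !mxE; lra.
have QQ : Q *m Q = Q.
  rewrite /Q mulmxBl !mulmxBr -!scalemxAl -!scalemxAr A4 A3 mulmxA A3.
  by apply/matrixP=> i j; rewrite !mxE; lra.
have -> : A = P + 2^-1 *: Q by apply/matrixP=> i j; rewrite !mxE; lra.
have uP : u *m P = u.
  by rewrite /P mulmxBr -scalemxAr mulmxA !uA scaler_nat mulr2n addrK.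
have P0 : (0 < \rank P)%N.
  rewrite lt0n mxrank_eq0; apply: contraNneq u0 => P0.
  by rewrite -uP P0 mulmx0.
rewrite mxtraceD mxtraceZ !mxtrace_idem //.
by rewrite ltr_wpDr ?ltr0n // mulr_ge0 ?invr_ge0 ?ler0n.
Qed.

Lemma linfunE_linear (R : fieldType) (U V : vectType R) (f : U -> V) :
  linear f -> linfun f =1 f.
Proof.
move=> Hf.
pose h := GRing.isSemilinear.Build R U V *:%R f (GRing.semilinear_linear Hf).
pose g : {linear U -> V} := HB.pack f h.
exact: (lfunE g).
Qed.

(* The Krylov spaces [span (x, f x, ..., f^(n-1) x)] stop growing. *)
Lemma exists_krylov (R : fieldType) (V : vectType R) (f : 'End(V)) (x : V) :
  exists n, let W := <<[seq iter i f x | i <- iota 0 n.+1]>>%VS in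
    (f @: W <= W)%VS.
Proof.
pose W n := <<[seq iter i f x | i <- iota 0 n]>>%VS.
have WS n : (W n <= W n.+1)%VS.
  by rewrite /W -addn1 iotaD map_cat span_cat addvSl.
have fW n : (f @: W n <= W n.+1)%VS.
  rewrite limg_span -map_comp; apply/span_subvP=> y /mapP[i].
  rewrite mem_iota add0n => /andP[_ lt_in] ->.
  by apply/memv_span/mapP; exists i.+1; rewrite // mem_iota.
have exP : exists n, (\dim (W n) < n)%N.
  by exists (\dim {:V}).+1; rewrite ltnS dimvS ?subvf.
case: (ex_minnP exP) => [[|n] // ltWn min_n].
(* At the least index n+1 with dim W(n+1) < n+1, minimality gives dim W(n+1) <= n <= dim W(n). *)
have WW : W n = W n.+1.
  apply/eqP; rewrite eqEdim WS /=.
  rewrite (leq_trans (_ : _ <= n)%N) // leqNgt.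
  by apply/negP=> /min_n; rewrite ltnn.
by exists n; rewrite /= -/(W n.+1) -{1}WW fW.
Qed.

(* Linear arithmetic on coordinates; consumes the vector equations in the
   context. *)
Ltac vlra :=
  intros; apply: v2r_inj; apply/rowP; let i := fresh in intro i;
  repeat match goal with
    H : @eq ?T _ _ |- _ =>
      generalize (congr1 (fun v : T => v2r v 0 i) H); clear H
    end;
  rewrite ?(linearD, linearN, linearZ) /= ?mxE; lra.

(** * Polarized Jordan identity and inner derivations *)

Section JordanAlgebra.
Variables (R : realType) (V : vectType R) (mul : V -> V -> V).
Hypothesis Hjordan : jordan_algebra mul.

Local Notation "x ** y" := (mul x y) (at level 40, left associativity).
Let jl : forall a x y z, (a *: x + y) ** z = a *: (x ** z) + y ** z.
Proof. by case: Hjordan. Qed.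
Let jC : forall x y, x ** y = y ** x.
Proof. by case: Hjordan. Qed.
Let jJ : forall x y, x ** x ** y ** x = x ** x ** (y ** x).
Proof. by case: Hjordan. Qed.

Let jDl x y z : (x + y) ** z = x ** z + y ** z.
Proof. by rewrite -[x]scale1r jl !scale1r. Qed.
Let jDr x y z : z ** (x + y) = z ** x + z ** y.
Proof. by rewrite jC jDl ![_ ** z]jC. Qed.

Lemma jordan_mul_linear x : linear (mul x).
Proof. by move=> a y z; rewrite ![x ** _]jC jl. Qed.

Definition Lmul x : 'End(V) := linfun (mul x).
Lemma LmulE x y : Lmul x y = x ** y.
Proof. exact: linfunE_linear (jordan_mul_linear x) y. Qed.

Let jNr x y : y ** (- x) = - (y ** x).
Proof. by rewrite -!LmulE linearN. Qed.
Let jNl x y : (- x) ** y = - (x ** y).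
Proof. by rewrite jC jNr jC. Qed.

(** The Jordan identity is cubic in its first variable; inclusion-exclusion over the partial sums of
    x + z + w isolates its trilinear part. *)
Lemma jordan_linearized x y z w :
  x ** z ** (y ** w) + z ** w ** (y ** x) + x ** w ** (y ** z) =
  x ** z ** y ** w + z ** w ** y ** x + x ** w ** y ** z.
Proof.
have J1 := jJ (x + z + w) y; have J2 := jJ (x + z) y; have J3 := jJ (x + w) y.
have J4 := jJ (z + w) y; have J5 := jJ x y; have J6 := jJ z y.
have J7 := jJ w y; move: J1 J2 J3 J4 J5 J6 J7.
rewrite !(jDl, jDr) ?[z ** x]jC ?[w ** x]jC ?[w ** z]jC.
vlra.
Qed.

Lemma Lmul_linear : linear Lmul.
Proof.
by move=> a x y; apply/lfunP=> z; rewrite add_lfunE scale_lfunE !LmulE jl.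
Qed.

(* The operator identity L_((xz)y) = L_(xz) L_y + L_(yx) L_z + L_(yz) L_x
   - L_x L_y L_z - L_z L_y L_x. *)
Lemma jordan_mul3 x y z w :
  x ** z ** y ** w = x ** z ** (y ** w) + y ** x ** (z ** w) + y ** z ** (x ** w)
    - x ** (y ** (z ** w)) - z ** (y ** (x ** w)).
Proof.
have J := jordan_linearized x y z w.
rewrite (jC _ (y ** x)) (jC (x ** w) (y ** z)) in J.
rewrite J (jC x (y ** _)) (jC y (z ** w)) (jC z (y ** _)) (jC y (x ** w)).
by rewrite addrAC addrK addrK.
Qed.

(** Subtract [jordan_mul3] for ((x u) z) v and for ((z u) x) v: the terms of the form (a b)(c d)
    cancel by symmetry, and the Leibniz rule remains. *)
Lemma jordan_commutator_derivation x z :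
  jderivation mul (fun y => z ** (x ** y) - x ** (z ** y)).
Proof.
split=> [a u v|u v].
  rewrite !(jC _ (_ + _), jl) ![(_ ** x)]jC ![(_ ** z)]jC.
  by rewrite scalerBr opprD addrACA.
rewrite !(jDl, jDr, jNl, jNr) (jC z (x ** u)) (jC x (z ** u)).
rewrite (jordan_mul3 x z u v) (jordan_mul3 z x u v).
rewrite (jC z x) (jC z u) (jC x u).
vlra.
Qed.

(** * Powers of one element and idempotents *)

Section Krylov.
Variable x : V.
(** No unit is assumed, so powers start at x: [pow i] is x^(i+1). *)
Let pow i := iter i (Lmul x) x.

Let powS i : pow i.+1 = x ** pow i.
Proof. exact: LmulE. Qed.

(** By [jordan_mul3], multiplication by a power is a polynomial in L_x, L_(x^2) and the
    multiplications by the two preceding powers. All of these commute with L_x, so the induction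
    carries two consecutive powers. *)
Lemma Lmul_pow_comm i v : x ** (pow i ** v) = pow i ** (x ** v).
Proof.
have Jx w : x ** (x ** x ** w) = x ** x ** (x ** w) by rewrite jC jJ (jC w).
have H : (forall v, x ** (pow i ** v) = pow i ** (x ** v)) /\
         (forall v, x ** (pow i.+1 ** v) = pow i.+1 ** (x ** v)).
  elim: i {v} => [|i [IH1 IH2]]; first by split=> // v; rewrite powS jC jJ (jC v).
  have E w : pow i.+2 ** w = pow i.+1 ** (x ** w) + x ** x ** (pow i ** w)
      + pow i.+1 ** (x ** w) - x ** (x ** (pow i ** w))
      - pow i ** (x ** (x ** w)).
    by rewrite 2!powS (jC x (x ** _)) jordan_mul3 -powS.
  split=> // v; rewrite !E !(jDr, jNr).
  by rewrite !(IH1, IH2, Jx).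
by case: H.
Qed.

(* On the span W of the powers of x, L_x is injective (if x y = 0 then y W = 0,
   so y^2 = 0), hence onto: x = x e with e in W, and e is the unit of W. *)
Lemma exists_idempotent : (forall y, y ** y = 0 -> y = 0) -> x != 0 ->
  exists2 e, e ** e = e & e != 0.
Proof.
move=> Hsq x0; have [n] := exists_krylov (Lmul x) x.
set W := <<_>>%VS => /= fW.
have WP (g : 'End(V)) : (forall i, g (pow i) = 0) -> forall w, w \in W -> g w = 0.
  move=> g0 w Ww; apply/eqP; rewrite -memv_ker.
  move: w Ww; apply/subvP/span_subvP => w /mapP[i _ ->].
  by rewrite memv_ker g0.
have xW : x \in W by apply/memv_span/mapP; exists 0%N.
have Wcomm w v : w \in W -> x ** (w ** v) = w ** (x ** v).
  move=> Ww; apply/eqP; rewrite -subr_eq0; apply/eqP.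
  have := WP (Lmul x \o Lmul v - Lmul (x ** v))%VF.
  move=> /(_ _ w Ww); rewrite add_lfunE opp_lfunE comp_lfunE !LmulE.
  rewrite (jC v) (jC _ w); apply=> i.
  rewrite add_lfunE opp_lfunE comp_lfunE !LmulE (jC v) Lmul_pow_comm.
  by rewrite (jC _ (pow i)) subrr.
have Winj : (W :&: lker (Lmul x) = 0)%VS.
  apply/eqP; rewrite -subv0; apply/subvP=> y /memv_capP[Wy].
  rewrite memv_ker LmulE memv0 => /eqP xy0; apply/eqP/Hsq.
  rewrite -LmulE; apply: WP => // i; rewrite LmulE.
  elim: i => [|i IHi]; first by rewrite jC.
  by rewrite powS -Wcomm // IHi -LmulE linear0.
have : x \in (Lmul x @: W)%VS.
  suff -> : (Lmul x @: W = W)%VS by [].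
  by apply/eqP; rewrite eqEdim fW (limg_dim_eq Winj) /=.
case/memv_imgP=> e We; rewrite LmulE => xe.
exists e; last first.
  by apply: contraNneq x0 => e0; rewrite xe e0 -LmulE linear0.
(* As e lies in W, it suffices that L_e - id vanish on every power of x. *)
apply/eqP; rewrite -subr_eq0 -{3}[e]id_lfunE -LmulE -opp_lfunE -add_lfunE.
apply/eqP; apply: WP => // i; rewrite add_lfunE opp_lfunE id_lfunE LmulE.
apply/eqP; rewrite subr_eq0; apply/eqP.
elim: i => [|i IHi]; first by rewrite jC -xe.
by rewrite powS -Wcomm // IHi.
Qed.
End Krylov.

(** * The trace form *)

Let B := vbasis {:V}.
Definition ltrace (f : 'End(V)) : R := \tr (mxof B B f).
Definition trform x y := ltrace (Lmul (x ** y)).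

Lemma ltrace_linear a f g : ltrace (a *: f + g) = (a * ltrace f + ltrace g)%R.
Proof. by rewrite /ltrace linearP /= mxtraceD mxtraceZ. Qed.

Lemma ltrace_comp f g : ltrace (f \o g)%VF = ltrace (g \o f)%VF.
Proof.
have bB := vbasisP {:V}.
by rewrite /ltrace !(mxof_comp _ _ bB) mxtrace_mulC.
Qed.

Lemma trformC x y : trform x y = trform y x.
Proof. by rewrite /trform jC. Qed.

Lemma trform_linear a x y z :
  trform (a *: x + y) z = (a * trform x z + trform y z)%R.
Proof. by rewrite /trform jl Lmul_linear ltrace_linear. Qed.

Lemma ltrace_Lmul_derivation D x : jderivation mul D -> ltrace (Lmul (D x)) = 0.
Proof.
case=> Dl DM; pose f : 'End(V) := linfun D.
have fE y : f y = D y by rewrite linfunE_linear.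
have -> : Lmul (D x) = -1 *: (Lmul x \o f)%VF + (f \o Lmul x)%VF.
  apply/lfunP=> y; rewrite add_lfunE scale_lfunE !comp_lfunE !fE !LmulE DM.
  by rewrite scaleN1r addrC addrK.
by rewrite ltrace_linear ltrace_comp mulN1r addNr.
Qed.

Lemma trform_derivation D x y : jderivation mul D ->
  trform (D x) y = - trform x (D y).
Proof.
move=> HD; apply/eqP; rewrite -addr_eq0 -[X in X + _]mul1r.
rewrite /trform -ltrace_linear -Lmul_linear scale1r.
by case: (HD) => _ <-; rewrite ltrace_Lmul_derivation.
Qed.

Lemma trform_assoc x y z : trform (x ** y) z = trform x (y ** z).
Proof.
have := ltrace_Lmul_derivation y (jordan_commutator_derivation x z).
rewrite (jC z (x ** y)) (jC z y) -[_ - _]addrC -scaleN1r Lmul_linear.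
rewrite ltrace_linear mulN1r => /eqP; rewrite addrC subr_eq0.
by move/eqP.
Qed.

(** Setting x = y = z = e in [jordan_mul3] gives the Peirce equation 2 L_e^3 = 3 L_e^2 - L_e; the
    fixed vector is e itself. *)
Lemma ltrace_idempotent_gt0 e : e ** e = e -> e != 0 -> 0 < ltrace (Lmul e).
Proof.
move=> ee e0; have bB := vbasisP {:V}.
apply: (mxtrace_peirce_gt0 (u := rVof B e)); last 2 first.
- by rewrite -rVof_app // LmulE ee.
- by rewrite rVof_eq0.
rewrite -!(mxof_comp _ _ bB) -linearZ /=.
rewrite -linearZ -linearB /=; congr mxof; apply/lfunP=> v.
rewrite add_lfunE opp_lfunE !scale_lfunE !comp_lfunE !LmulE.
have := jordan_mul3 e e e v; rewrite !ee.
set a := e ** v; set b := e ** a; set c := e ** b ; vlra.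
Qed.

Lemma trform_nondegenerate : formally_real mul -> jsimple mul ->
  forall x, (forall y, trform x y = 0) -> x = 0.
Proof.
move=> Hfr [[x0 [y0 xy0]] Hs].
have Hsq y : y ** y = 0 -> y = 0.
  move=> yy; apply: (Hfr 1%N (fun=> y) _ ord0).
  by rewrite big_ord1.
have [e ee e0] : exists2 e, e ** e = e & e != 0.
  apply: (exists_idempotent (x := x0) Hsq).
  by apply: contraNneq xy0 => ->; rewrite jC -LmulE linear0.
(* The radical is realized as the kernel of the map from V to its dual, so that it is a [{vspace V}]
   to which simplicity applies. *)
pose T : 'Hom(V, 'Hom(V, R^o)) := linfun (fun x => linfun (trform x : V -> R^o)).
have TE x y : T x y = trform x y.
  have E z w : linfun (trform z : V -> R^o) w = trform z w.
    apply: linfunE_linear => a u v.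
    by rewrite trformC trform_linear !(trformC z).
  rewrite -E; congr (fun_of_lfun _ y); apply: linfunE_linear => a u v.
  apply/lfunP=> w; rewrite add_lfunE scale_lfunE !E.
  exact: trform_linear.
have TP x : reflect (forall y, trform x y = 0) (x \in lker T).
  rewrite memv_ker; apply: (iffP eqP) => [T0 y|x_0].
    by rewrite -TE T0 zero_lfunE.
  by apply/lfunP=> y; rewrite TE zero_lfunE.
have [|T0|T1] := Hs (lker T).
- move=> x y /TP y_0; apply/TP=> z.
  by rewrite jC trform_assoc.
- by move=> x /TP; rewrite T0 memv0 => /eqP.
have /TP/(_ e) : e \in lker T by rewrite T1 memvf.
rewrite /trform ee => /eqP.
by rewrite gt_eqF // ltrace_idempotent_gt0.
Qed.
End JordanAlgebra.

(** * From 2-local derivations to derivations *)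

Theorem theorem5p4 (R : realType) (V : vectType R) (mul : V -> V -> V) :
  jordan_algebra mul -> formally_real mul -> jsimple mul ->
  jexceptional mul ->
  forall Delta : V -> V, two_local_derivation mul Delta -> jderivation mul Delta.
Proof.
move=> HJ Hfr Hs _ Delta HD.
pose t := trform mul.
have nd u v : (forall y, t u y = t v y) -> u = v.
  move=> uv; apply/eqP; rewrite -subr_eq0; apply/eqP.
  apply: (trform_nondegenerate HJ Hfr Hs) => y.
  by rewrite -scaleN1r addrC trform_linear // -/t uv mulN1r addNr.
have skew x y : t (Delta x) y = - t x (Delta y).
  by have [D [dD -> ->]] := HD x y; rewrite /t trform_derivation.
(* Paired with any z, skewness moves [Delta] onto z, leaving an expression linear in the first
   argument; nondegeneracy then removes z. *)
have lin a x y : Delta (a *: x + y) = a *: Delta x + Delta y.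
  apply: nd => z; rewrite skew /t !trform_linear // -/t !skew.
  by rewrite mulrN opprD.
split=> // x y.
have [mull mulC _] := HJ.
have sq z : Delta (mul z z) = 2 *: mul z (Delta z).
  have [D [[_ dD] -> ->]] := HD z (mul z z).
  by rewrite dD mulC scaler_nat.
have DD u v : Delta (u + v) = Delta u + Delta v.
  by rewrite -[u]scale1r lin !scale1r.
have mDl u v w : mul (u + v) w = mul u w + mul v w.
  by rewrite -[u]scale1r mull !scale1r.
have mDr u v w : mul w (u + v) = mul w u + mul w v.
  by rewrite mulC mDl !(mulC w).
have := sq (x + y).
rewrite !(mDl, mDr, DD) !sq (mulC y x) (mulC y (Delta x)) ; vlra.
Qed.
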